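(* Let $(Z_n)_{n\in\mathbb{N}}$ be a sequence of Fréchet spaces, let $X$ be a Fréchet space, and for each $n\in\mathbb{N}$ let $T_n:Z_n\to X$ be a continuous linear operator. Let $$Y:=\operatorname{span}\Big(\bigcup_{n\in\mathbb{N}}T_n(Z_n)\Big)\subset X.$$ If $Y$ is not closed in $X$, then the complement $X\setminus Y$ is spaceable.
   Context: All spaces are vector spaces over the same scalar field $\mathbb{K}\in\{\mathbb{R},\mathbb{C}\}$. A Fréchet space is a complete, metrizable (Hausdorff) locally convex topological vector space; equivalently, its topology is generated by a countable separating family of seminorms and is complete. The span is the algebraic linear span (finite linear combinations). A subset $A$ of a topological vector space $X$ is called spaceable if $A\cup\{0\}$ contains a closed infinite-dimensional linear subspace of $X$. Thus $X\setminus Y$ is spaceable precisely when there is a closed infinite-dimensional linear subspace $F\subset X$ with $F\setminus\{0\}\subset X\setminus Y$, i.e. $F\cap Y=\{0\}$. *)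

(* Defs.v *)
From HB Require Import structures.
From mathcomp Require Import all_boot all_order all_algebra.
From mathcomp Require Import complex.
From mathcomp Require Import all_classical all_reals all_analysis.

Set Implicit Arguments.
Unset Strict Implicit.
Unset Printing Implicit Defensive.

Import Order.TTheory GRing.Theory Num.Theory.
Import numFieldNormedType.Exports.

Local Open Scope classical_set_scope.
Local Open Scope ring_scope.

Variant scalar_kind := RealScalars | ComplexScalars.

Definition scalars (R : realType) (k : scalar_kind) : numFieldType :=
  match k with
  | RealScalars => R
  | ComplexScalars => R[i]
  end.

Definition metrizable (R : realType) (T : topologicalType) : Prop :=
  exists d : T -> T -> R,
    [/\ forall x y, d x y = 0 <-> x = y,
        forall x y, d x y = d y x,
        forall x y z, d x z <= d x y + d y z
      & forall x, nbhs x = nbhs_ball_ (fun y e => [set z | d y z < e]) x].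

(* [tvsType] does not relate the uniform structure of [E], to which [cauchy]
   refers, to its addition; [frechet_entourage] makes it the uniform structure
   of the topological vector space.  Local convexity is part of [Tvs], and the
   Hausdorff property follows from [frechet_metrizable]. *)
HB.mixin Record Tvs_isFrechet (R : realType) (K : numFieldType) E & Tvs K E := {
  frechet_entourage : forall A : set (E * E), entourage A <->
    exists2 U : set E, nbhs (0 : E) U & forall x y, U (x - y) -> A (x, y) ;
  frechet_metrizable : metrizable R E ;
  frechet_complete : forall F : set_system E, ProperFilter F -> cauchy F ->
    exists x : E, F --> x
}.

#[short(type="frechetType")]
HB.structure Definition Frechet (R : realType) (K : numFieldType) :=
  {E of Tvs K E & Tvs_isFrechet R K E}.

Section LinearSubsets.
Context {K : numFieldType} {E : lmodType K}.
Implicit Types A F : set E.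

Definition lin_span A : set E :=
  [set x | exists n (a : 'I_n -> K) (v : 'I_n -> E),
     (forall i, A (v i)) /\ x = \sum_(i < n) a i *: v i].

Definition linear_subspace F : Prop :=
  F 0 /\ forall (a : K) u v, F u -> F v -> F (a *: u + v).

Definition finite_dimensional F : Prop :=
  exists S : set E, [/\ finite_set S, S `<=` F & F `<=` lin_span S].

End LinearSubsets.

Definition spaceable {K : numFieldType} {X : tvsType K} (A : set X) : Prop :=
  exists F : set X,
    [/\ linear_subspace F, closed F, ~ finite_dimensional F
      & F `<=` A `|` [set 0]].

(* Main.v *)
Require Import Defs.
From HB Require Import structures.
From mathcomp Require Import all_boot all_order all_algebra.
From mathcomp Require Import complex.
From mathcomp Require Import all_classical all_reals all_analysis.
From mathcomp Require Import ring lra.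

Set Implicit Arguments.
Unset Strict Implicit.
Unset Printing Implicit Defensive.

Import Order.TTheory GRing.Theory Num.Theory.
Import numFieldNormedType.Exports.

Local Open Scope classical_set_scope.
Local Open Scope ring_scope.

(** Let [S n] be the sum of the ranges of the first [n] operators, so that [Y]
    is the increasing union of the [S n].  The plan is to find vectors [x i] of
    [X] and continuous linear forms [phi i], biorthogonal to each other, such
    that [phi i] tends to zero along subsequences at every point of [Y], while
    [x i] tends to zero fast.  Split the indices into infinitely many infinite
    classes and let [F] consist of those [y] in the closed span of the [x i] for
    which [phi i y] depends on the class of [i] only.  Every class contributes
    to [F] the sum of its [x i], so [F] is infinite-dimensional.  If [y] is in
    both [F] and [Y], then in every class the constant value of [phi i y] is
    approached by a sequence that tends to zero, so all [phi i y] vanish.  To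
    conclude [y = 0] from this, the construction also provides a family of
    forms [psi i] that separates the points of the closed span and vanishes at
    all but finitely many [x j]: on the closed span [psi i] is then a linear
    combination of the [phi j], so it vanishes at [y] too.  This is
    [spaceable_complement_of_thin].

    Its hypothesis is that [Y] is covered by the multiples of countably many
    sets [C n] that are thin: forms bounded by one on [C n] and vanishing on a
    prescribed finite set still take the value one at arbitrarily small
    vectors.  This leaves room for every step of the recursion: [phi i] can be
    small on [C n], vanish at the earlier vectors, and equal one at a small
    [x i], and the finitely many earlier forms can be made to vanish at [x i]
    by a finite-rank correction ([project_kernels]).  Each [C n] has to be
    treated infinitely often in every class, whence an enumeration with
    infinite repetition.

    It remains to find thin sets when [Y] is not closed.  If no [S n] is dense
    in [Y], the [S n] themselves are thin, as shown by the Hahn-Banach theorem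
    ([thin_subspace]).  If [S n0] is dense in [Y], then for every [n >= n0] some
    neighbourhood of zero in the product of the first [n] spaces has an image
    in [S n] whose closure contains no relative neighbourhood of zero of
    [S n0]: otherwise the successive approximation of the open mapping theorem
    would show that [S n] contains the closure of [S n0]
    ([almost_open_closure_sub]), and [Y] would be closed.  Such an image is thin
    ([thin_of_closure]). *)

(** * Scalars *)

Section Scalars.
Context {R : realType}.

Let dense_rat (a e : R) : 0 < e ->
  exists n, `|a - ratr (odflt 0%Q (unpickle n))| < e.
Proof.
move=> e0; have [|r] := @rat_in_itvoo R (a - e) (a + e); first by lra.
rewrite in_itv/= => /andP[h1 h2]; exists (pickle r); rewrite pickleK/=.
by rewrite ltr_norml; apply/andP; split; lra.
Qed.

Lemma scalars_dense_seq k : exists q : nat -> scalars R k,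
  forall a e, 0 < e -> exists n, `|a - q n| < e.
Proof.
case: k => /=; first by exists (fun n => ratr (odflt 0%Q (unpickle n))).
pose q (n : nat) : R := ratr (odflt 0%Q (unpickle n)).
pose c (n : nat) := odflt (0%N, 0%N) (unpickle n).
exists (fun n => Complex (q (c n).1) (q (c n).2)) => -[a b] [e e'].
rewrite ltcE/= => /andP[/eqP-> e0].
have e2 : 0 < e / 2 by rewrite divr_gt0.
have [n hn] := dense_rat a e2; have [m hm] := dense_rat b e2.
exists (pickle (n, m)); rewrite /c pickleK/=.
rewrite -/(q n) -/(q m) in hn hm *.
have -> : (a +i* b - q n +i* q m = (a - q n)%:C + 'i * (b - q m)%:C)%C.
  by rewrite [LHS]complexE.
apply: le_lt_trans (ler_normD _ _) _.
rewrite normrM !normc_def/= !expr0n !expr1n/= addr0 add0r sqrtr1 mul1r addr0.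
rewrite !sqrtr_sqr -rmorphD/= complexr0 ltcR; lra.
Qed.

Lemma scalars_archimedean k (e : scalars R k) : 0 < e ->
  exists n, n.+1%:R^-1 < e.
Proof.
have archi (x : R) : 0 < x -> exists n, n.+1%:R^-1 < x.
  move=> x0; exists (Num.truncn x^-1); rewrite invf_plt ?posrE//.
  exact: truncnS_gt.
case: k e => /=; first exact: archi.
move=> [e e']; rewrite ltcE/= => /andP[/eqP-> /archi[n hn]]; exists n.
rewrite complexr0 -(rmorph_nat (real_complex R)) -fmorphV/= ltcR//.
Qed.

End Scalars.

(** * Linear forms, absolutely convex sets and subspaces *)

Definition absolutely_convex (K : numDomainType) (V : lmodType K) (A : set V) :=
  forall a b x y, `|a| + `|b| <= 1 -> A x -> A y -> A (a *: x + b *: y).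

Definition linear_form (K : numDomainType) (V : lmodType K) (f : V -> K) :=
  forall a x y, f (a *: x + y) = a * f x + f y.

Section LinearForms.
Context {K : numDomainType} {V : lmodType K} {f : V -> K}.
Context (fl : linear_form f).

Lemma linear_form0 : f 0 = 0.
Proof.
have := fl 1 0 0; rewrite scaler0 addr0 mul1r => h.
by apply: (addrI (f 0)); rewrite addr0 -h.
Qed.

Lemma linear_formZ a x : f (a *: x) = a * f x.
Proof. by have := fl a x 0; rewrite linear_form0 !addr0. Qed.

Lemma linear_formD x y : f (x + y) = f x + f y.
Proof. by have := fl 1 x y; rewrite scale1r mul1r. Qed.

Lemma linear_formB x y : f (x - y) = f x - f y.
Proof. by rewrite linear_formD -scaleN1r linear_formZ mulN1r. Qed.

Lemma linear_form_sum I (r : seq I) (P : pred I) (F : I -> V) :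
  f (\sum_(i <- r | P i) F i) = \sum_(i <- r | P i) f (F i).
Proof.
by elim/big_rec2: _ => [|i y1 y2 _ <-]; rewrite ?linear_form0// linear_formD.
Qed.

End LinearForms.

Section AbsolutelyConvex.
Context {K : numFieldType} {V : lmodType K} {A : set V}.
Context (Aac : absolutely_convex A).

Lemma absolutely_convexZ a x : `|a| <= 1 -> A x -> A (a *: x).
Proof.
move=> a1 Ax; have := Aac (a := a) (b := 0) (x := x) (y := x).
by rewrite normr0 addr0 scale0r addr0; apply.
Qed.

Lemma absolutely_convexN x : A x -> A (- x).
Proof. by rewrite -scaleN1r; apply: absolutely_convexZ; rewrite normrN1. Qed.

Lemma absolutely_convex0 : A !=set0 -> A 0.
Proof.
move=> [x Ax]; rewrite -(scale0r x).
by apply: absolutely_convexZ => //; rewrite normr0.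
Qed.

Lemma absolutely_convex_half x y : A x -> A y -> A (2^-1 *: (x + y)).
Proof.
rewrite scalerDr; apply: Aac; rewrite ger0_norm ?invr_ge0//.
by rewrite -mulr2n -(mulr_natr 2^-1) mulVf.
Qed.

End AbsolutelyConvex.

Section LinearSubspaces.
Context {K : numFieldType} {V : lmodType K} {F : set V}.
Context (Flin : linear_subspace F).

Lemma linear_subspaceZ a x : F x -> F (a *: x).
Proof.
by move=> Fx; rewrite -[_ *: _]addr0; apply: Flin.2 => //; exact: Flin.1.
Qed.

Lemma linear_subspaceD x y : F x -> F y -> F (x + y).
Proof. by move=> Fx Fy; rewrite -[x]scale1r; exact: Flin.2. Qed.

Lemma linear_subspace_sum n (v : 'I_n -> V) : (forall i, F (v i)) ->
  F (\sum_(i < n) v i).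
Proof.
by move=> Fv; apply: big_ind => //; [exact: Flin.1|exact: linear_subspaceD].
Qed.

Lemma linear_subspace_absolutely_convex : absolutely_convex F.
Proof.
by move=> a b x y _ Fx Fy; apply: Flin.2 => //; exact: linear_subspaceZ.
Qed.

End LinearSubspaces.

Section Biorthogonal.
Context {K : numFieldType} {E : lmodType K}.

Lemma biorthogonal_infinite_dimensional (F : set E)
    (f : nat -> E) (g : nat -> E -> K) :
  (forall i, F (f i)) -> (forall i, linear_form (g i)) ->
  (forall i j, g i (f j) = (i == j)%:R) -> ~ finite_dimensional F.
Proof.
move=> Ff gl gf [_ [/finite_seqP[s ->] _ Fs]].
have Fcoord x : F x ->
    exists a : 'I_(size s) -> K, x = \sum_(l < size s) a l *: s`_l.
  move=> /Fs[n [a [v [vs ->]]]].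
  exists (fun l : 'I_(size s) => \sum_(i < n | index (v i) s == l) a i).
  under [RHS]eq_bigr do rewrite scaler_suml.
  rewrite (exchange_big_dep xpredT)//=; apply: eq_bigr => i _.
  have vis : (index (v i) s < size s)%N by rewrite index_mem; exact: vs.
  rewrite (big_pred1 (Ordinal vis)) /= ?nth_index//; first exact: vs.
have [a fE] := choice (fun i => Fcoord (f i) (Ff i)).
pose M : 'M[K]_((size s).+1, size s) := \matrix_(i, l) a i l.
(* one more vector than generators: the coordinates are linearly dependent *)
have : kermx M != 0.
  rewrite -mxrank_eq0 mxrank_ker -lt0n subn_gt0 ltnS; exact: rank_leq_col.
move=> /rowV0Pn[c /sub_kermxP cM] /rV0Pn[i0]; apply/negP/negPn/eqP.
have : \sum_(i < (size s).+1) c ord0 i *: f i = 0.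
  under eq_bigr do rewrite fE scaler_sumr.
  rewrite exchange_big/= big1// => l _.
  under eq_bigr do rewrite scalerA.
  rewrite -scaler_suml; have /matrixP/(_ ord0 l) := cM.
  rewrite !mxE => cl; rewrite (_ : \sum_(_ < _) _ = 0) ?scale0r// -[RHS]cl.
  by apply: eq_bigr => i _; rewrite !mxE.
move=> /(congr1 (g i0)); rewrite (linear_form0 (gl _)) (linear_form_sum (gl _)).
rewrite (bigD1 i0)//= big1 => [|i ii0]; last first.
  rewrite (linear_formZ (gl _)) gf eq_sym.
  by rewrite (negPf (ii0 : i != i0 :> nat)) mulr0.
by rewrite (linear_formZ (gl _)) gf eqxx mulr1 addr0.
Qed.

End Biorthogonal.

(** * Separation of points from absolutely convex sets *)

Section RealHahnBanach.
Context {R : realType} {V : lmodType R}.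
Implicit Types (p q u : V -> R) (x y : V).

Definition sublinear p :=
  (forall x y, p (x + y) <= p x + p y) /\
  (forall r x, 0 < r -> p (r *: x) = r * p x).

Lemma sublinear_from_le p : (forall x y, p (x + y) <= p x + p y) ->
  (forall r x, 0 < r -> p (r *: x) <= r * p x) -> sublinear p.
Proof.
move=> pD pZ; split=> // r x r0; apply/eqP; rewrite eq_le pZ //=.
have ri : 0 < r^-1 by rewrite invr_gt0.
have := pZ _ (r *: x) ri; rewrite scalerA mulVf ?gt_eqF// scale1r.
by rewrite ler_pdivlMl.
Qed.

Lemma sublinear0 p : sublinear p -> p 0 = 0.
Proof.
move=> [_ pZ]; have := pZ 2 0 (ltr0Sn _ _); rewrite scaler0 => h; lra.
Qed.

Lemma sublinear_ge_opp p x : sublinear p -> - p (- x) <= p x.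
Proof.
move=> sp; have := sp.1 x (- x); rewrite subrr sublinear0// => h; lra.
Qed.

(** The infimum is taken over the whole ray spanned by [a] so that the result
    is again sublinear; it takes the smallest value at [- a] that sublinearity
    allows. *)
Lemma sublinear_lower p (a : V) : sublinear p -> exists q,
  [/\ sublinear q, forall x, q x <= p x & q (- a) <= - p a].
Proof.
move=> sp; have [pD pZ] := sp.
pose E x := [set p (x + t *: a) - t * p a | t in [set t : R | 0 <= t]].
have pZ0 t x : 0 <= t -> p (t *: x) = t * p x.
  rewrite le_eqVlt => /orP[/eqP<-|]; last exact: pZ.
  by rewrite scale0r mul0r sublinear0.
have Elb x : lbound (E x) (- p (- x)).
  move=> _ [t t0 <-]; have := pD (x + t *: a) (- x).
  by rewrite addrAC subrr add0r pZ0// => h; lra.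
have Ehas x : has_lbound (E x) by exists (- p (- x)).
have E0 x : E x !=set0 by exists (p (x + 0 *: a) - 0 * p a), 0 => //=.
have infle x t : 0 <= t -> inf (E x) <= p (x + t *: a) - t * p a.
  by move=> t0; apply: ge_inf => //; exists t.
exists (fun x => inf (E x)); split.
- apply: sublinear_from_le => [x y|r x r0].
    apply/ler_addgt0Pr => e e0.
    have e2 : 0 < e / 2 by rewrite divr_gt0.
    have [_ [s s0 <-] hs] := inf_adherent e2 (conj (E0 x) (Ehas x)).
    have [_ [t t0 <-] ht] := inf_adherent e2 (conj (E0 y) (Ehas y)).
    have := infle (x + y) (s + t) (addr_ge0 s0 t0).
    have := pD (x + s *: a) (y + t *: a).
    by rewrite addrACA -scalerDl => h1 h2; lra.
  rewrite -ler_pdivrMl//; apply: lb_le_inf => // _ [t t0 <-].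
  rewrite ler_pdivrMl//; apply: le_trans (infle _ _ (mulr_ge0 (ltW r0) t0)) _.
  by rewrite -scalerA -scalerDr pZ// mulrBr mulrA.
- by move=> x; have := infle x 0 (lexx _); rewrite scale0r addr0 mul0r subr0.
- have := infle (- a) 1 ler01.
  by rewrite scale1r addNr sublinear0// mul1r sub0r.
Qed.

(** A minimal sublinear functional is linear, since lowering it in any
    direction leaves it unchanged; Zorn's lemma provides a minimal one. *)
Lemma sublinear_minorant p : sublinear p -> exists u,
  [/\ forall x y, u (x + y) = u x + u y, forall r x, u (r *: x) = r * u x
    & forall x, u x <= p x].
Proof.
move=> sp.
pose T := {q : V -> R | sublinear q /\ forall x, q x <= p x}.
pose below (s t : T) : bool := `[< forall x, sval t x <= sval s x >].
have [||||[u [su up]] umin] := @Zorn T below.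
- by move=> t; apply/asboolP.
- move=> r s t /asboolP rs /asboolP st; apply/asboolP => x.
  exact: le_trans (st x) (rs x).
- move=> [s Ps] [t Pt] /asboolP/= st /asboolP/= ts; apply: eq_exist => /=.
  by apply/funext => x; apply/eqP; rewrite eq_le st ts.
- move=> A Atot; have [A0|/set0P[s0 As0]] := eqVneq A set0.
    have Pp : sublinear p /\ forall x, p x <= p x by [].
    by exists (exist _ p Pp) => s; rewrite A0.
  pose E x := [set sval s x | s in A].
  have Ehas x : has_lbound (E x).
    exists (- p (- x)) => _ [s As <-]; have [ss sle] := svalP s.
    by apply: le_trans (sublinear_ge_opp _ ss); rewrite lerN2.
  have E0 x : E x !=set0 by exists (sval s0 x), s0.
  have infle x s : A s -> inf (E x) <= sval s x.
    by move=> As; apply: ge_inf => //; exists s.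
  have Pi : sublinear (fun x => inf (E x)) /\ forall x, inf (E x) <= p x.
    split; last by move=> x; apply: le_trans (infle x _ As0) ((svalP s0).2 x).
    apply: sublinear_from_le => [x y|r x r0].
      apply/ler_addgt0Pr => e e0.
      have e2 : 0 < e / 2 by rewrite divr_gt0.
      have [_ [s As <-] hs] := inf_adherent e2 (conj (E0 x) (Ehas x)).
      have [_ [t At <-] ht] := inf_adherent e2 (conj (E0 y) (Ehas y)).
      have [/asboolP h|/asboolP h] := Atot _ _ As At.
        have := infle (x + y) t At; have := (svalP t).1.1 x y.
        by have := h x; lra.
      have := infle (x + y) s As; have := (svalP s).1.1 x y.
      by have := h y; lra.
    rewrite -ler_pdivrMl//; apply: lb_le_inf => // _ [s As <-].
    by rewrite ler_pdivrMl// -(svalP s).1.2//; exact: infle.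
  exists (exist _ (fun x => inf (E x)) Pi) => s As.
  by apply/asboolP => x /=; exact: infle.
have uN x : u (- x) = - u x.
  have [q [sq qu qx]] := sublinear_lower x su.
  have Pq : sublinear q /\ forall x, q x <= p x.
    by split=> // y; apply: le_trans (qu y) (up y).
  have /(congr1 sval)/= qe := umin (exist _ q Pq) (asboolT qu).
  have := sublinear_ge_opp (- x) su; rewrite opprK => h.
  by apply/eqP; rewrite eq_le h andbT; move: qx; rewrite qe.
have uD x y : u (x + y) = u x + u y.
  apply/eqP; rewrite eq_le su.1/=; have := su.1 (- x) (- y).
  by rewrite -opprD !uN => h; lra.
exists u; split=> // r x; have [r0|r0|<-] := ltgtP 0 r.
- exact: su.2.
- by rewrite -[r in LHS]opprK scaleNr uN su.2 ?oppr_gt0// mulNr opprK.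
- by rewrite scale0r mul0r sublinear0.
Qed.

(** Lowering the gauge of [A] in the direction [- x0] before minorizing it
    forces the value at [x0]. *)
Lemma real_separation (A : set V) (x0 : V) :
  (forall t x y, 0 <= t <= 1 -> A x -> A y -> A (t *: x + (1 - t) *: y)) ->
  (forall x, exists2 r : R, 0 < r & A (r^-1 *: x)) -> ~ A x0 ->
  exists u, [/\ forall x y, u (x + y) = u x + u y,
    forall r x, u (r *: x) = r * u x, forall x, A x -> u x <= 1 & 1 <= u x0].
Proof.
move=> Acvx Aabs NAx0.
pose E x := [set r : R | 0 < r /\ A (r^-1 *: x)].
have E0 x : E x !=set0 by have [r r0 Ar] := Aabs x; exists r.
have Elb x : has_lbound (E x) by exists 0 => r [/ltW].
pose p x := inf (E x).
have ple x r : 0 < r -> A (r^-1 *: x) -> p x <= r by move=> *; apply: ge_inf.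
have A0 : A 0 by have [r _] := Aabs 0; rewrite scaler0.
have sp : sublinear p.
  apply: sublinear_from_le => [x y|r x r0].
    apply/ler_addgt0Pr => e e0.
    have e2 : 0 < e / 2 by rewrite divr_gt0.
    have [s [s0 As] hs] := inf_adherent e2 (conj (E0 x) (Elb x)).
    have [t [t0 At] ht] := inf_adherent e2 (conj (E0 y) (Elb y)).
    have st0 : 0 < s + t by rewrite addr_gt0.
    suff h : A ((s + t)^-1 *: (x + y)).
      by have := ple _ _ st0 h; rewrite /p in hs ht *; lra.
    have -> : (s + t)^-1 *: (x + y) =
        (s / (s + t)) *: (s^-1 *: x) + (1 - s / (s + t)) *: (t^-1 *: y).
      rewrite !scalerA scalerDr; congr (_ *: _ + _ *: _).
        by field; rewrite !gt_eqF.
      by field; rewrite !gt_eqF.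
    apply: Acvx => //; rewrite divr_ge0 ?(ltW s0) ?(ltW st0)//=.
    by rewrite ler_pdivrMr// mul1r lerDl ltW.
  rewrite -ler_pdivrMl//; apply: lb_le_inf => // s [s0 As].
  rewrite ler_pdivrMl//; apply: ple; first exact: mulr_gt0.
  by rewrite scalerA invfM -mulrA [s^-1 * _]mulrC mulrA mulVf ?mul1r ?gt_eqF.
have px0 : 1 <= p x0.
  apply: lb_le_inf => // r [r0 Ar]; rewrite leNgt; apply/negP => r1.
  apply: NAx0; have -> : x0 = r *: (r^-1 *: x0) + (1 - r) *: 0.
    by rewrite scaler0 addr0 scalerA divff ?scale1r ?gt_eqF.
  by apply: Acvx => //; rewrite !ltW.
have [q [sq qp qx0]] := sublinear_lower x0 sp.
have [u [uD uZ uq]] := sublinear_minorant sq.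
exists u; split=> // [x Ax|].
  apply: le_trans (uq x) _; apply: le_trans (qp x) _.
  by apply: ple; rewrite // invr1 scale1r.
have := uq (- x0); rewrite -scaleN1r uZ scaleN1r => h; lra.
Qed.

End RealHahnBanach.

(** A synonym, to keep the real scaling apart from the complex one. *)
Definition realified (R : realType) (V : lmodType R[i]) : Type := V.

Section Realified.
Context {R : realType} {V : lmodType R[i]}.

HB.instance Definition _ := GRing.Zmodule.on (realified V).

Definition realified_scale (r : R) (x : realified V) : realified V :=
  (r%:C)%C *: (x : V).

Let scaleA a b x :
  realified_scale a (realified_scale b x) = realified_scale (a * b) x.
Proof. by rewrite /realified_scale scalerA -rmorphM. Qed.

Let scale1 : left_id 1 realified_scale.
Proof. by move=> x; rewrite /realified_scale scale1r. Qed.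

Let scaleDr : right_distributive realified_scale +%R.
Proof. by move=> a x y; rewrite /realified_scale scalerDr. Qed.

Let scaleDl x : {morph realified_scale^~ x : a b / a + b}.
Proof. by move=> a b; rewrite /realified_scale rmorphD scalerDl. Qed.

HB.instance Definition _ :=
  GRing.Zmodule_isLmodule.Build R (realified V) scaleA scale1 scaleDr scaleDl.

End Realified.

Section Separation.
Context {R : realType}.

Let separation_real (V : lmodType R) (A : set V) (x0 : V) :
  absolutely_convex A -> (forall x, exists2 r, r != 0 & A (r *: x)) -> ~ A x0 ->
  exists f, [/\ linear_form f, forall x, A x -> `|f x| <= 1 & f x0 = 1].
Proof.
move=> Aac Aabs NAx0.
have AZ := absolutely_convexZ Aac.
have [|x|//|u [uD uZ uA ux0]] := @real_separation R V A x0.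
- move=> t x y /andP[t0 t1] Ax Ay; apply: Aac => //.
  by rewrite !ger0_norm ?subr_ge0// addrC subrK.
- have [r r0 Ar] := Aabs x; exists `|r|^-1; first by rewrite invr_gt0 normr_gt0.
  have -> : `|r|^-1^-1 *: x = (`|r| / r) *: (r *: x).
    by rewrite invrK scalerA mulfVK.
  by apply: AZ => //; rewrite normrM normfV normr_id divff ?normr_eq0.
have ux00 : u x0 != 0 by rewrite gt_eqF// (lt_le_trans ltr01).
exists (fun x => u x / u x0); split; last by rewrite divff.
  by move=> a x y; rewrite uD uZ mulrDl mulrA.
move=> x Ax; rewrite normrM normfV ler_pdivrMr ?normr_gt0// mul1r.
apply: le_trans (ler_norm _); apply: le_trans ux0; rewrite ler_norml uA//.
have := uA (-1 *: x); rewrite uZ => h; rewrite lerNl -mulN1r h//.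
by apply: AZ => //; rewrite normrN1.
Qed.

(** A real-linear functional [u] is the real part of the complex-linear
    [x |-> u x - i u (i x)], whose modulus on a circled set is controlled by
    its real part. *)
Let separation_complex (V : lmodType R[i]) (A : set V) (x0 : V) :
  absolutely_convex A -> (forall x, exists2 r, r != 0 & A (r *: x)) -> ~ A x0 ->
  exists f, [/\ linear_form f, forall x, A x -> `|f x| <= 1 & f x0 = 1].
Proof.
move=> Aac Aabs NAx0.
have AZ := absolutely_convexZ Aac.
have [|x|//|u [uD uZ uA ux0]] := @real_separation R (realified V) A x0.
- move=> t x y /andP[t0 t1] Ax Ay; apply: Aac => //.
  rewrite !ger0_norm ?ler0c ?subr_ge0//.
  by rewrite rmorphB rmorph1 addrC subrK.
- have [r r0 Ar] := Aabs x; exists (complex.Re `|r|)^-1.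
    have : 0 < `|r| by rewrite normr_gt0.
    by rewrite ltcE invr_gt0 => /andP[].
  have -> : (complex.Re `|r|)^-1^-1 *: (x : realified V) =
      (`|r| / r) *: (r *: x).
    have hr : ((complex.Re `|r|)%:C)%C = `|r|.
      by rewrite [in RHS]normc_def normc_def.
    by rewrite invrK scalerA mulfVK// -[in RHS]hr.
  by apply: AZ => //; rewrite normrM normfV normr_id divff ?normr_eq0.
pose f (x : V) : R[i] := Complex (u x) (- u ('i%C *: x)).
have fl : linear_form f.
  have uZC (r : R) (x : V) : u ((r%:C)%C *: x) = r * u x := uZ r x.
  have uN (x : V) : u (- x) = - u x.
    by rewrite -scaleN1r -(rmorphN1 (real_complex R)) uZC mulN1r.
  move=> [a b] x y; rewrite /f.
  have -> : (a +i* b)%C *: x = (a%:C)%C *: x + (b%:C)%C *: ('i%C *: x).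
    by rewrite scalerA -scalerDl; congr (_ *: _); rewrite [LHS]complexE/= mulrC.
  rewrite !scalerDr !scalerA ![('i * _)%C]mulrC -!scalerA !uD !uZC.
  rewrite [in 'i%C *: ('i%C *: x)]scalerA -expr2 sqr_i scaleN1r uN.
  by simpc; congr Complex; ring.
have Ref x : complex.Re (f x) = u x by [].
have fx0 : f x0 != 0.
  by apply/eqP => /(congr1 (@complex.Re R)); rewrite Ref/= => h; lra.
have fx01 : 1 <= `|f x0|.
  rewrite normc_def lecE/= eqxx/=; apply: le_trans ux0 _.
  apply: le_trans (ler_norm _) _; rewrite -sqrtr_sqr ler_wsqrtr// lerDl.
  exact: sqr_ge0.
exists (fun x => f x / f x0); split; last by rewrite divff.
  by move=> a x y; rewrite fl mulrDl mulrA.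
move=> x Ax; rewrite normrM normfV ler_pdivrMr ?normr_gt0// mul1r.
apply: le_trans fx01.
have [->|fx] := eqVneq (f x) 0; first by rewrite normr0 ler01.
(* rotate [x] so that the value of [f] becomes real *)
have -> : `|f x| = f ((`|f x| / f x) *: x) by rewrite (linear_formZ fl) mulfVK.
have := uA _ (AZ (`|f x| / f x) x _ Ax).
rewrite normrM normfV normr_id divff ?normr_eq0// => /(_ (lexx _)).
rewrite -Ref (linear_formZ fl) mulfVK// => h; rewrite normc_def in h *.
by rewrite lecE eqxx.
Qed.

Lemma separation k (V : lmodType (scalars R k)) (A : set V) (x0 : V) :
  absolutely_convex A -> (forall x, exists2 r, r != 0 & A (r *: x)) -> ~ A x0 ->
  exists f, [/\ linear_form f, forall x, A x -> `|f x| <= 1 & f x0 = 1].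
Proof.
by case: k V A x0 => V A x0; [exact: separation_real|exact: separation_complex].
Qed.

End Separation.

(** * Topological vector spaces and continuous forms *)

Section NeighbourhoodsOfZero.
Context {K : numFieldType} {X : tvsType K}.
Implicit Types (U W A : set X) (x y : X).

Lemma nbhs_sub x y U : nbhs (x - y) U -> nbhs y [set z | U (x - z)].
Proof.
move=> Uxy; have h : (fun z : X => x - z) @ y --> x - y.
  apply: (@continuous_comp _ _ _ (pair x) (fun z : X * X => z.1 - z.2)).
    by apply: cvg_pair => /=; [exact: cvg_cst|exact: cvg_id].
  exact: sub_continuous.
exact: h.
Qed.

Lemma closure_approx A x :
  closure A x <-> forall U, nbhs (0 : X) U -> exists2 a, A a & U (x - a).
Proof.
split=> [Ax U U0|h B Bx].
  have [|a [Aa Ua]] := Ax [set a | U (x - a)]; last by exists a.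
  by apply: nbhs_sub; rewrite subrr.
have [|a Aa] := h [set z | B (x - z)]; first by apply: nbhs_sub; rewrite subr0.
by rewrite /= opprB addrC subrK => Ba; exists a.
Qed.

Lemma nbhs0_addW U : nbhs (0 : X) U ->
  exists2 W, nbhs (0 : X) W & forall x y, W x -> W y -> U (x + y).
Proof.
move=> U0; have := @add_continuous X (0, 0) U; rewrite /= addr0 => /(_ U0).
move=> [[W1 W2] /= [W10 W20] WU]; exists (W1 `&` W2); first exact: filterI.
by move=> x y [W1x _] [_ W2y]; exact: (WU (x, y)).
Qed.

Lemma nbhs0_scale r U : nbhs (0 : X) U -> nbhs (0 : X) [set x | U (r *: x)].
Proof.
move=> U0; have := @scale_continuous K X (r, 0) U.
rewrite /= scaler0 => /(_ U0).
move=> [[W1 W2] /= [W1r W20] WU]; apply: filterS W20 => x W2x.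
exact: (WU (r, x) (conj (nbhs_singleton W1r) W2x)).
Qed.

Lemma nbhs0_absorb U x : nbhs (0 : X) U ->
  exists2 e : K, 0 < e & forall t, `|t| < e -> U (t *: x).
Proof.
move=> U0; have := @scale_continuous K X (0, x) U.
rewrite /= scale0r => /(_ U0).
move=> [[W1 W2] /= [/nbhs_ballP[e e0 We] W2x] WU]; exists e => // t te.
apply: (WU (t, x)); split=> /=; last exact: nbhs_singleton W2x.
by apply: We; rewrite -ball_normE/= sub0r normrN.
Qed.

Lemma nbhs0_absorbing U x : nbhs (0 : X) U ->
  exists2 r : K, r != 0 & U (r *: x).
Proof.
move=> /(nbhs0_absorb x)[e e0 Ue]; exists (e / 2).
  by rewrite gt_eqF ?divr_gt0.
apply: Ue; rewrite ger0_norm ?divr_ge0 ?ltW// ltr_pdivrMr//.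
by rewrite ltr_pMr// ltr1n.
Qed.

(** The circled core of a convex set is absolutely convex. *)
Lemma nbhs0_absolutely_convex U : nbhs (0 : X) U -> exists W,
  [/\ absolutely_convex W, nbhs (0 : X) W & W `<=` U].
Proof.
move=> U0; have [B Bcvx [Bopen Bbasis]] := @locally_convex K X.
have [C [BC C0] CU] := Bbasis 0 U U0.
have {}Ccvx t x y : 0 <= t -> t <= 1 -> C x -> C y -> C (t *: x + (1 - t) *: y).
  move=> t0 t1 Cx Cy.
  have := Bcvx C (mem_set BC) x y (Itv01 t0 t1) (mem_set Cx) (mem_set Cy).
  by move=> /set_mem.
exists [set x | forall t, `|t| <= 1 -> C (t *: x)]; split.
- move=> a b x y ab Dx Dy t t1.
  have [ab0|ab0] := eqVneq (`|a| + `|b|) 0.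
    move/eqP: ab0; rewrite paddr_eq0// !normr_eq0 => /andP[/eqP-> /eqP->].
    by rewrite !scale0r addr0 scaler0.
  have ablt : 0 < `|a| + `|b| by rewrite lt_neqAle eq_sym ab0 addr_ge0.
  have DZ (c : K) z : (forall t, `|t| <= 1 -> C (t *: z)) ->
      exists2 z', C z' & (t * c) *: z = `|c| *: z'.
    move=> Dz; have [->|c0] := eqVneq c 0.
      by exists 0 => //; rewrite normr0 mulr0 !scale0r.
    exists ((t * c / `|c|) *: z).
      apply: Dz; rewrite !normrM normfV normr_id mulfK//.
      by rewrite normr_eq0.
    by rewrite scalerA [in RHS]mulrC mulfVK// normr_eq0.
  have [x' Cx' xE] := DZ a x Dx; have [y' Cy' yE] := DZ b y Dy.
  have -> : t *: (a *: x + b *: y) = (`|a| + `|b|) *: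
      ((`|a| / (`|a| + `|b|)) *: x' + (1 - `|a| / (`|a| + `|b|)) *: y') +
      (1 - (`|a| + `|b|)) *: 0.
    rewrite scaler0 addr0 !scalerDr !scalerA xE yE; congr (_ *: _ + _ *: _).
      by rewrite mulrC mulfVK.
    by rewrite mulrBr mulr1 [_ * (_ / _)]mulrC mulfVK// addrC addKr.
  apply: (Ccvx (`|a| + `|b|)); rewrite ?(ltW ablt)//.
  by apply: Ccvx => //; rewrite ?divr_ge0// ?ler_pdivrMr// ?mul1r ?lerDl// ltW.
- have := @scale_continuous K X (0, 0) C; rewrite /= scale0r.
  move=> /(_ (open_nbhs_nbhs (conj (Bopen _ BC) C0))).
  move=> [[W1 W2] /= [/nbhs_ballP[e e0 We] W20] WC].
  have e2 : 0 < e / 2 by rewrite divr_gt0.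
  apply: filterS (nbhs0_scale (e / 2)^-1 W20) => x W2x t t1.
  have -> : t *: x = (t * (e / 2)) *: ((e / 2)^-1 *: x).
    by rewrite scalerA mulfK// gt_eqF.
  apply: (WC (_, _)); split=> //=; apply: We.
  rewrite -ball_normE/= sub0r normrN normrM (ger0_norm (ltW e2)).
  apply: le_lt_trans (ler_piMl (ltW e2) t1) _.
  by rewrite ltr_pdivrMr// ltr_pMr// ltr1n.
- by move=> x Dx; rewrite -[x]scale1r; apply: CU; apply: Dx; rewrite normr1.
Qed.

End NeighbourhoodsOfZero.

Definition continuous_form (K : numFieldType) (X : tvsType K) (f : X -> K) :=
  linear_form f /\ nbhs (0 : X) [set x | `|f x| <= 1].

Section ContinuousForms.
Context {K : numFieldType} {X : tvsType K}.
Implicit Types (f g : X -> K) (A : set X).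

Lemma continuous_form_small f e : continuous_form f -> 0 < e ->
  nbhs (0 : X) [set x | `|f x| <= e].
Proof.
move=> [fl f1] e0; apply: filterS (nbhs0_scale e^-1 f1) => x /=.
by rewrite (linear_formZ fl) normrM normfV (gtr0_norm e0) ler_pdivrMl// mulr1.
Qed.

Lemma continuous_formZ a f :
  continuous_form f -> continuous_form (fun x => a * f x).
Proof.
move=> [fl f1]; split=> [c x y|]; first by rewrite fl; ring.
by apply: filterS (nbhs0_scale a f1) => x /=; rewrite (linear_formZ fl).
Qed.

Lemma continuous_form_comb a b f g : continuous_form f -> continuous_form g ->
  continuous_form (fun x => a * f x + b * g x).
Proof.
move=> cf cg; split=> [c x y|]; first by rewrite cf.1 cg.1; ring.
have half : 0 < 2^-1 :> K by rewrite invr_gt0.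
apply: filterS (filterI (continuous_form_small (continuous_formZ a cf) half)
  (continuous_form_small (continuous_formZ b cg) half)) => x [h1 h2] /=.
apply: le_trans (ler_normD _ _) _; apply: le_trans (lerD h1 h2) _.
by rewrite -mulr2n -(mulr_natr 2^-1) mulVf.
Qed.

Lemma continuous_form_closure f A x : continuous_form f ->
  (forall a, A a -> f a = 0) -> closure A x -> f x = 0.
Proof.
move=> cf fA /closure_approx Ax; have [//|] := eqVneq (f x) 0.
rewrite -normr_gt0 => fx0.
have fx2 : 0 < `|f x| / 2 by rewrite divr_gt0.
have [a Aa /=] := Ax _ (continuous_form_small cf fx2).
rewrite (linear_formB cf.1) (fA a)// subr0 ler_pdivlMr//.
by rewrite ger_pMr// lern1.
Qed.

Lemma continuous_form0 : continuous_form (fun _ : X => 0 : K).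
Proof.
split=> [a x y|]; first by rewrite mulr0 addr0.
by apply: filterS filterT => x _ /=; rewrite normr0.
Qed.

Lemma continuous_form_sum n (c : nat -> K) (f : nat -> X -> K) :
  (forall i, continuous_form (f i)) ->
  continuous_form (fun x => \sum_(l < n) c l * f l x).
Proof.
move=> cf; elim: n => [|n IH].
  under [X in continuous_form X]eq_fun do rewrite big_ord0.
  exact: continuous_form0.
have := continuous_form_comb 1 (c n) IH (cf n).
by congr continuous_form; apply/funext => x; rewrite big_ord_recr/= mul1r.
Qed.

End ContinuousForms.

Section ContinuousSeparation.
Context {R : realType} {k : scalar_kind} {X : tvsType (scalars R k)}.
Implicit Types (A : set X) (x : X).

Lemma separation_nbhs0 A x : absolutely_convex A -> nbhs (0 : X) A -> ~ A x ->
  exists f, [/\ continuous_form f, forall a, A a -> `|f a| <= 1 & f x = 1].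
Proof.
move=> Aac A0 NAx.
have [f [fl fA fx]] := separation Aac (fun y => nbhs0_absorbing y A0) NAx.
by exists f; split=> //; split=> //; exact: filterS A0.
Qed.

Lemma separation_closure A x : absolutely_convex A -> A !=set0 ->
  ~ closure A x ->
  exists f, [/\ continuous_form f, forall a, A a -> `|f a| <= 1 & f x = 1].
Proof.
move=> Aac Ane NAx.
have [U U0 AU] : exists2 U, nbhs (0 : X) U & forall a, A a -> ~ U (x - a).
  apply: contrapT => h; apply: NAx; apply/closure_approx => U U0.
  apply: contrapT => h'; apply: h; exists U => // a Aa Ua.
  by apply: h'; exists a.
have [W [Wac W0 WU]] := nbhs0_absolutely_convex U0.
pose B : set X := [set b | exists a w, [/\ A a, W w & b = a + w]].
have A0 := absolutely_convex0 Aac Ane.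
have B0 : nbhs (0 : X) B.
  by apply: filterS W0 => w Ww; exists 0, w; split; rewrite ?add0r.
have Bac : absolutely_convex B.
  move=> a b y1 y2 ab [a1 [w1 [Aa1 Ww1 ->]]] [a2 [w2 [Aa2 Ww2 ->]]].
  exists (a *: a1 + b *: a2), (a *: w1 + b *: w2).
  split; [exact: Aac|exact: Wac|].
  by rewrite !scalerDr addrACA.
have [|f [cf fB fx]] := separation_nbhs0 Bac B0 (x := x).
  move=> [a [w [Aa Ww xE]]]; apply: (AU a Aa); apply: WU.
  by rewrite xE addrC addKr.
exists f; split=> // a Aa; apply: fB; exists a, 0; rewrite addr0; split=> //.
exact: nbhs_singleton W0.
Qed.

End ContinuousSeparation.

Section SequenceSpan.
Context {K : numFieldType} {X : tvsType K}.

Lemma closure_linear_subspace (S : set X) :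
  linear_subspace S -> linear_subspace (closure S).
Proof.
move=> [S0 SD]; split; first exact: subset_closure.
move=> a u v /closure_approx Su /closure_approx Sv.
apply/closure_approx => U U0.
have [W W0 WU] := nbhs0_addW U0.
have [u' Su' Wu] := Su _ (nbhs0_scale a W0); have [v' Sv' Wv] := Sv _ W0.
exists (a *: u' + v'); first exact: SD.
by rewrite opprD addrACA -scalerBr; exact: WU.
Qed.

Definition sequence_span (x : nat -> X) : set X :=
  [set y | exists n (a : nat -> K), y = \sum_(l < n) a l *: x l].

Lemma sequence_span_linear x : linear_subspace (sequence_span x).
Proof.
split; first by exists 0%N, (fun=> 0); rewrite big_ord0.
have pad n (a : nat -> K) N : (n <= N)%N ->
    \sum_(l < n) a l *: x l =
    \sum_(l < N) (if (l < n)%N then a l else 0) *: x l.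
  move=> nN; rewrite (big_ord_widen _ (fun l => a l *: x l) nN) big_mkcond/=.
  by apply: eq_bigr => l _; case: ifP => //; rewrite scale0r.
move=> c _ _ [n [a ->]] [m [b ->]]; exists (maxn n m).
exists (fun l => c * (if (l < n)%N then a l else 0) +
  (if (l < m)%N then b l else 0)).
rewrite (pad n a _ (leq_maxl n m)) (pad m b _ (leq_maxr n m)).
rewrite scaler_sumr -big_split/=.
by apply: eq_bigr => l _; rewrite scalerA -scalerDl.
Qed.

End SequenceSpan.

(** * Frechet spaces *)

(** A neighbourhood base of zero that halves in each step, so that every series
    with [m]-th term in [V m] is Cauchy. *)
Definition fundamental_sequence (K : numFieldType) (X : tvsType K)
    (V : nat -> set X) :=
  [/\ forall m, absolutely_convex (V m), forall m, nbhs (0 : X) (V m),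
      forall m x y, V m.+1 x -> V m.+1 y -> V m (x + y)
    & forall U, nbhs (0 : X) U -> exists m, V m `<=` U].

Section Frechet.
Context {R : realType} {K : numFieldType} {E : frechetType R K}.

(** Taking the [m]-th set to be the intersection of the first absolutely convex
    neighbourhoods, shrunk by [2 ^+ m], avoids a recursive choice. *)
Lemma fundamental_sequence_exists :
  exists V : nat -> set E, fundamental_sequence V.
Proof.
have [d [d0 dC dD nbhsE]] := @frechet_metrizable R K E.
pose B n : set E := [set z | d 0 z < n.+1%:R^-1].
have B0 n : nbhs (0 : E) (B n) by rewrite nbhsE; exists n.+1%:R^-1 => //=.
have Bbase U : nbhs (0 : E) U -> exists n, B n `<=` U.
  rewrite nbhsE => -[e e0 eU].
  exists (Num.truncn e^-1) => z Bz; apply: eU => /=.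
  by apply: lt_le_trans Bz _; rewrite invf_ple ?posrE// ltW// truncnS_gt.
have [W Wn] := choice (fun n => nbhs0_absolutely_convex (B0 n)).
pose V m : set E := [set x | forall i, (i <= m)%N -> W i (2 ^+ m *: x)].
exists V; split.
- move=> m a b x y ab Vx Vy i im; have [Wac _ _] := Wn i.
  by rewrite scalerDr !scalerA ![2 ^+ m * _]mulrC -!scalerA; apply: Wac; auto.
- move=> m; have : nbhs (0 : E) [set x | forall i, (i < m.+1)%N -> W i x].
    elim: m.+1 => [|n IH]; first by apply: filterS filterT.
    have [_ Wn0 _] := Wn n; apply: filterS (filterI IH Wn0) => x [h1 h2] i.
    by rewrite ltnS leq_eqVlt => /predU1P[->//|]; exact: h1.
  by move=> /(nbhs0_scale (2 ^+ m)); apply: filterS => x h i im; apply: h.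
- move=> m x y Vx Vy i im; have [Wac _ _] := Wn i.
  have := absolutely_convex_half Wac (Vx i (leqW im)) (Vy i (leqW im)).
  by rewrite -scalerDr scalerA exprS mulKf.
- move=> U /Bbase[n BU]; exists n => x Vx; have [Wac _ WB] := Wn n.
  apply: BU; apply: WB.
  have := absolutely_convexZ Wac (a := 2 ^- n) _ (Vx n (leqnn n)).
  rewrite scalerA mulVf ?expf_neq0// scale1r; apply.
  by rewrite normfV normrX ger0_norm// invf_le1 ?exprn_gt0// exprn_ege1// ler1n.
Qed.

Lemma fundamental_decr (V : nat -> set E) m n :
  fundamental_sequence V -> (m <= n)%N -> V n `<=` V m.
Proof.
move=> [Vac V0 VD _] /subnKC <-; elim: (n - m)%N => [|i IH] x.
  by rewrite addn0.
rewrite addnS => Vx; apply: IH; rewrite -[x]addr0; apply: VD => //.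
exact: nbhs_singleton.
Qed.

Lemma fundamental_series_cvg (V : nat -> set E) (z : nat -> E) :
  fundamental_sequence V -> (forall m, V m (z m)) ->
  exists s, forall U, nbhs (0 : E) U ->
    exists N, forall m, (N <= m)%N -> U (s - \sum_(l < m) z l).
Proof.
move=> Vfund Vz; have [Vac V0 VD Vbase] := Vfund.
pose S m := \sum_(l < m) z l.
have tail n m : V m (\sum_(m.+1 <= l < m.+1 + n) z l).
  elim: n m => [|n IH] m.
    by rewrite addn0 big_geq//; exact: nbhs_singleton.
  by rewrite addnS big_ltn ?ltnS ?leq_addr// -addSn; apply: VD => //; exact: IH.
have SV m n n' : (m < n)%N -> (n <= n')%N -> V m (S n' - S n).
  case: n => // n; rewrite ltnS => mn nn'; apply: (fundamental_decr Vfund mn).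
  have := tail (n' - n.+1)%N n; rewrite subnKC// /S -!(big_mkord xpredT z).
  rewrite [in V n (_ - _)](big_cat_nat _ nn')//= [_ - _]addrC addKr.
  exact.
have SVs m n n' : (m < n)%N -> (m < n')%N -> V m (S n' - S n).
  move=> mn mn'; have [nn'|/ltnW nn'] := leqP n n'; first exact: SV.
  by rewrite -opprB; apply: absolutely_convexN => //; exact: SV.
have [|s Ss] := @frechet_complete R K E (S @ \oo) _.
  move=> A /(frechet_entourage A).1[U U0 UA]; have [m VU] := Vbase U U0.
  have tailP : (S @ \oo) (S @` [set n | (m < n)%N]).
    by exists m.+1 => // n /= mn; exists n.
  exists (S @` [set n | (m < n)%N], S @` [set n | (m < n)%N]) => //.
  by move=> [_ _] /= [[n mn <-] [n' mn' <-]]; apply: UA; apply: VU; exact: SVs.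
exists s => U U0.
have /Ss[N _ NU] : nbhs s [set y | U (s - y)].
  by apply: nbhs_sub; rewrite subrr.
by exists N => m Nm; exact: NU.
Qed.

Lemma frechet_separated (y : E) : y != 0 -> exists2 U, nbhs (0 : E) U & ~ U y.
Proof.
move=> y0; have [d [d0 dC dD nbhsE]] := @frechet_metrizable R K E.
have dy : 0 < d 0 y.
  have := dD 0 y 0; rewrite (d0 0 0).2// (dC y) => dge; rewrite lt_neqAle.
  apply/andP; split; last by lra.
  by apply: contra y0 => /eqP/esym/(d0 _ _).1 ->.
by exists [set z | d 0 z < d 0 y]; rewrite /= ?ltxx// nbhsE; exists (d 0 y).
Qed.

Lemma fundamental_sum (V : nat -> set E) m n (z : nat -> E) :
  fundamental_sequence V -> (forall l, V (m.+1 + l)%N (z l)) ->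
  V m (\sum_(l < n) z l).
Proof.
move=> [Vac V0 VD _]; elim: n m z => [|n IH] m z Vz.
  by rewrite big_ord0; exact: nbhs_singleton.
rewrite big_ord_recl; apply: VD; first by have := Vz 0%N; rewrite addn0.
by apply: (IH m.+1 (fun l => z l.+1)) => l; rewrite addSnnS.
Qed.

End Frechet.

(** * Biorthogonal sequences avoiding thin sets *)

(** Dependent choice in which each new term may depend on all earlier ones. *)
Lemma history_choice (A : Type) (P : seq A -> A -> Prop) :
  (forall h, exists a, P h a) ->
  exists f : nat -> A, forall n, P (mkseq f n) (f n).
Proof.
move=> /choice[g Pg]; pose h n := iter n (fun s => rcons s (g s)) [::].
exists (fun n => g (h n)) => n.
suff -> : mkseq (fun n => g (h n)) n = h n by exact: Pg.
by elim: n => // n IH; rewrite mkseqS IH.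
Qed.

(** The exponent of two in [n] takes every value at arbitrarily large [n]. *)
Lemma enumerate_infinitely_often (A : countType) (a0 : A) :
  exists f : nat -> A, forall a N, exists2 n, (N <= n)%N & f n = a.
Proof.
exists (fun n => odflt a0 (unpickle (logn 2 n))) => a N.
exists (2 ^ pickle a * N.*2.+1)%N.
  apply: leq_trans (leq_pmull _ _); last by rewrite expn_gt0.
  by rewrite -addnn leqW// leq_addr.
rewrite lognM ?expn_gt0// pfactorK// (_ : logn 2 N.*2.+1 = 0)%N.
  by rewrite addn0 pickleK.
by apply/eqP; rewrite -leqn0 leqNgt logn_gt0 mem_primes/= dvdn2 /= odd_double.
Qed.

Section ThinSets.
Context {R : realType} {k : scalar_kind} {X : frechetType R (scalars R k)}.
Local Notation K := (scalars R k).
Implicit Types (C D : set X).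

(** A finite-rank perturbation [Q] of the identity maps [D] into the common
    kernel of finitely many forms; a form that vanishes at the finitely many
    vectors [gs] of the perturbation does not notice it. *)
Lemma project_kernels D (n : nat) (theta : nat -> X -> K) : linear_subspace D ->
  (forall i, (i < n)%N -> continuous_form (theta i)) ->
  exists (gs : seq X) (Q : X -> X),
  [/\ {in gs, forall g, D g}, forall x, D x -> D (Q x),
      forall x i, D x -> (i < n)%N -> theta i (Q x) = 0,
      forall f, linear_form f -> {in gs, forall g, f g = 0} ->
        forall x, f (Q x) = f x
    & forall U, nbhs (0 : X) U -> nbhs (0 : X) [set x | U (Q x)]].
Proof.
move=> Dlin; elim: n => [|n IH] ctheta; first by exists [::], id.
have [i ltin|gs [Q [gsD QD Q0 Qf QU]]] := IH.
  by apply: ctheta; rewrite ltnW.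
have ct := ctheta n (ltnSn n).
have [tQ|] := pselect (forall x, D x -> theta n (Q x) = 0).
  exists gs, Q; split=> // x i Dx; rewrite ltnS leq_eqVlt => /predU1P[->|].
    exact: tQ.
  exact: Q0.
move=> /existsNP[x1 /not_implyP[Dx1 /eqP tx1]].
pose g := (theta n (Q x1))^-1 *: Q x1.
have Dg : D g by apply: (linear_subspaceZ Dlin); exact: QD.
have tg : theta n g = 1 by rewrite (linear_formZ ct.1) mulVf.
exists (g :: gs), (fun x => - theta n (Q x) *: g + Q x); split.
- by move=> x; rewrite inE => /predU1P[->//|]; exact: gsD.
- by move=> x Dx; apply: Dlin.2 => //; exact: QD.
- move=> x i Dx ltin; rewrite (ctheta i ltin).1.
  move: ltin; rewrite ltnS leq_eqVlt => /predU1P[->|ltin].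
    by rewrite tg mulr1 addNr.
  rewrite (Q0 x i)// addr0 /g (linear_formZ (ctheta i (ltnW ltin)).1).
  by rewrite (Q0 x1 i)// !mulr0.
- move=> f fl fg x; rewrite fl fg ?mem_head// mulr0 add0r.
  apply: Qf => // z zgs.
  by apply: fg; rewrite inE zgs orbT.
- move=> U /nbhs0_addW[W W0 WU].
  have [e e0 We] := nbhs0_absorb g W0.
  have e2 : 0 < e / 2 by rewrite divr_gt0.
  apply: filterS (filterI (QU _ W0) (QU _ (continuous_form_small ct e2))).
  move=> x [h1 /= h2].
  apply: WU => //; apply: We; rewrite normrN; apply: le_lt_trans h2 _.
  by rewrite ltr_pdivrMr// ltr_pMr// ltr1n.
Qed.

(** The polar of [C] stays unbounded on every neighbourhood of zero of [D], even
    when it is restricted to the forms that vanish on a given finite subset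
    of [D]. *)
Definition thin D C := forall (es : seq X) U, {in es, forall e, D e} ->
  nbhs (0 : X) U -> exists f x, [/\ continuous_form f,
    forall c, C c -> `|f c| <= 1, {in es, forall e, f e = 0}, D x
    & U x /\ f x = 1].

(** A finite subset of [Y] lies in some [S N], and a form that separates a point
    of [Y] from [S N] vanishes on [S N], so its size can be chosen freely. *)
Lemma thin_subspace (Y : set X) (S : nat -> set X) :
  (forall n, linear_subspace (S n)) ->
  (forall n m, (n <= m)%N -> S n `<=` S m) ->
  (forall y, Y y -> exists n, S n y) ->
  (forall n, ~ Y `<=` closure (S n)) -> (forall a y, Y y -> Y (a *: y)) ->
  forall n, thin Y (S n).
Proof.
move=> Slin Smono YS NYS YZ n es U esY U0.
have [N nN esN] : exists2 N, (n <= N)%N & {in es, forall e, S N e}.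
  elim: es esY => [|e es IH] esY; first by exists n.
  have [e' e's|N nN esN] := IH; first by apply: esY; rewrite inE e's orbT.
  have [M SMe] := YS e (esY e (mem_head _ _)).
  exists (maxn N M); first by rewrite leq_max nN.
  move=> e'; rewrite inE => /predU1P[->|/esN].
    by apply: Smono SMe; rewrite leq_maxr.
  by apply: Smono; rewrite leq_maxl.
have /existsNP[y /not_implyP[Yy NSy]] := NYS N.
have [|f [cf fS fy]] :=
    separation_closure (linear_subspace_absolutely_convex (Slin N)) _ NSy.
  by exists 0; exact: (Slin N).1.
have fS0 z : S N z -> f z = 0.
  move=> Sz; have [//|fz] := eqVneq (f z) 0.
  have := fS _ (linear_subspaceZ (Slin N) (2 / f z) Sz).
  by rewrite (linear_formZ cf.1) mulfVK// normr_nat lern1.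
have [r r0 Ury] := nbhs0_absorbing y U0.
exists (fun x => r^-1 * f x), (r *: y); split=> //.
- exact: continuous_formZ.
- by move=> c Sc; rewrite fS0 ?mulr0 ?normr0//; exact: (Smono _ _ nN).
- by move=> e ees; rewrite fS0 ?mulr0//; exact: esN.
- exact: YZ.
- by split=> //; rewrite (linear_formZ cf.1) fy mulr1 mulVf.
Qed.

(** Forms [f] in the polar of [C] that are large near zero come from separation.
    To make them vanish at a further point [e], on which the polar is bounded,
    take a fixed [f1] of the polar with [f1 e != 0] and subtract
    [f e / f1 e * f1], a bounded multiple of [f1]. *)
Lemma thin_of_closure (D C : set X) :
  linear_subspace D -> absolutely_convex C ->
  (forall e, D e -> exists c, C (c.+1%:R^-1 *: e)) ->
  (forall W, nbhs (0 : X) W -> exists d, [/\ D d, W d & ~ closure C d]) ->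
  thin D C.
Proof.
move=> Dlin Cac Cabs CW; elim=> [|e es IH] U esD U0.
  have [d [Dd Ud Nd]] := CW U U0.
  have [|f [cf fC fd]] := separation_closure Cac _ Nd.
    by have [c Cc] := Cabs 0 Dlin.1; exists (c.+1%:R^-1 *: 0).
  by exists f, d; split.
have esD' : {in es, forall e', D e'}.
  by move=> e' e's; apply: esD; rewrite inE e's orbT.
have [f1|/existsNP[f1 /not_implyP[[cf1 f1C f1es] /eqP f1e]]] := pselect
    (forall f, [/\ continuous_form f, forall c, C c -> `|f c| <= 1
      & {in es, forall e', f e' = 0}] -> f e = 0).
  have [f [x [cf fC fes Dx Ux]]] := IH U esD' U0; exists f, x; split=> //.
  by move=> e'; rewrite inE => /predU1P[->|]; [exact: f1|exact: fes].
have [c Ce] := Cabs e (esD e (mem_head _ _)).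
have c0 : 0 < c.+1%:R :> K by rewrite ltr0n.
pose M := c.+1%:R / `|f1 e|.
have M0 : 0 < M by rewrite divr_gt0// normr_gt0.
have M1 : 0 < 1 + M by rewrite addr_gt0.
have [W [Wac W0 WU]] := nbhs0_absolutely_convex U0.
have M20 : 0 < (2 * M)^-1 by rewrite invr_gt0 mulr_gt0.
(* [f1 x] is so small that the corrected form [g] is at least one half at [x];
   the factor [2 * (1 + M)] leaves room for the final normalization by [a] *)
have [f [x [cf fC fes Dx [[Wx /= f1x] fx]]]] := IH _ esD'
  (filterI (nbhs0_scale (2 * (1 + M)) W0) (continuous_form_small cf1 M20)).
pose g z := 1 * f z + (- (f e / f1 e)) * f1 z.
have cg : continuous_form g by exact: continuous_form_comb.
have fe : `|f e / f1 e| <= M.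
  rewrite normrM normfV ler_pM2r ?invr_gt0 ?normr_gt0//.
  have := fC _ Ce; rewrite (linear_formZ cf.1) normrM normfV normr_nat.
  by rewrite ler_pdivrMl// mulr1.
have gC z : C z -> `|g z| <= 1 + M.
  move=> Cz; rewrite /g mul1r; apply: le_trans (ler_normD _ _) _.
  apply: lerD; first exact: fC.
  by rewrite normrM normrN -[M]mulr1 ler_pM// f1C.
have gx : 2^-1 <= `|g x|.
  rewrite /g mul1r fx mulNr; apply: le_trans (lerB_normD _ _).
  rewrite normr1 normrN lerBrDr -lerBrDl normrM.
  apply: le_trans (ler_pM _ _ fe f1x) _ => //.
  by rewrite invfM mulrCA mulfV ?gt_eqF// mulr1 -[leRHS](_ : 2^-1 = _)//; field.
have gx0 : g x != 0.
  by rewrite -normr_gt0; apply: lt_le_trans gx; rewrite invr_gt0.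
pose a := (1 + M) / g x.
exists (fun z => (1 + M)^-1 * g z), (a *: x); split.
- exact: continuous_formZ.
- move=> z Cz; rewrite normrM normfV (gtr0_norm M1).
  by rewrite ler_pdivrMl// mulr1; exact: gC.
- move=> e'; rewrite /g inE => /predU1P[->|e's].
    by rewrite mul1r mulNr mulfVK// subrr mulr0.
  by rewrite (fes e')// (f1es e')// !mulr0 addr0 mulr0.
- exact: linear_subspaceZ.
split.
  apply: WU; have -> : a *: x = (g x * 2)^-1 *: ((2 * (1 + M)) *: x).
    by rewrite scalerA invfM -mulrA mulKf ?pnatr_eq0// mulrC.
  apply: absolutely_convexZ => //; rewrite normfV normrM normr_nat.
  rewrite invf_le1 ?mulr_gt0 ?normr_gt0//.
  by rewrite -ler_pdivrMr// mul1r.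
by rewrite (linear_formZ cg.1) /a mulfVK// mulVf// gt_eqF.
Qed.

(** Thinness is applied to the earlier vectors together with the range of the
    perturbation that moves a vector into the kernels of the earlier forms, so
    that the perturbation does not change the value of the new form.  The
    vector [d x] may involve the new vector [x]; this is what allows [psi] to
    detect all combinations of the vectors chosen so far. *)
Lemma extend_biorthogonal D C n (xs : nat -> X) (phis psis : nat -> X -> K)
    (U W : set X) (d : X -> X) : linear_subspace D -> thin D C ->
  (forall i, (i < n)%N -> D (xs i)) ->
  (forall i, (i < n)%N -> continuous_form (phis i)) ->
  (forall i, (i < n)%N -> continuous_form (psis i)) ->
  nbhs (0 : X) U -> absolutely_convex W -> nbhs (0 : X) W ->
  exists x phi psi, [/\ D x /\ U x, continuous_form phi, continuous_form psi,
    [/\ phi x = 1, forall i, (i < n)%N -> phi (xs i) = 0,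
      forall i, (i < n)%N -> phis i x = 0, forall i, (i < n)%N -> psis i x = 0
      & forall c, C c -> `|phi c| <= n.+1%:R^-1]
    & (forall w, W w -> `|psi w| <= 1) /\ (~ W (d x) -> psi (d x) = 1)].
Proof.
move=> Dlin Cthin xsD cphi cpsi U0 Wac W0.
pose theta i := if (i < n)%N then phis i else psis (i - n)%N.
have [|gs [Q [gsD QD Q0 Qf QU]]] := @project_kernels D (n + n)%N theta Dlin.
  move=> i; rewrite /theta; case: (ltnP i n) => [ltin _|lein].
    exact: cphi.
  by move=> ltinn; apply: cpsi; rewrite ltn_subLR.
have [|f [y [cf fC fes Dy [Uy fy]]]] := Cthin (mkseq xs n ++ gs) _ _
    (nbhs0_scale n.+1%:R (QU _ U0)).
  move=> e; rewrite mem_cat => /orP[xs_e|]; last exact: gsD.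
  have [i +] := elimT (@mapP nat X xs (iota 0 n) e) xs_e.
  by rewrite mem_iota => /= ltin ->; exact: xsD.
have n0 : n.+1%:R != 0 :> K by rewrite pnatr_eq0.
pose phi x := n.+1%:R^-1 * f x; pose x := Q (n.+1%:R *: y).
have cphi' : continuous_form phi := continuous_formZ _ cf.
have phix : phi x = 1.
  rewrite /phi /x Qf ?(linear_formZ cf.1) ?fy ?mulr1 ?mulVf//.
    exact: cf.1.
  by move=> g ggs; apply: fes; rewrite mem_cat ggs orbT.
have DZ a z : D z -> D (a *: z) by exact: linear_subspaceZ.
have [psi [cpsi' psiW psix]] : exists psi : X -> K, [/\ continuous_form psi,
    forall w, W w -> `|psi w| <= 1 & ~ W (d x) -> psi (d x) = 1].
  have [Wd|NWd] := pselect (W (d x)); last first.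
    by have [psi [c h1 h2]] := separation_nbhs0 Wac W0 NWd; exists psi.
  exists (fun=> 0); split=> //; first exact: continuous_form0.
  by move=> w _; rewrite normr0.
exists x, phi, psi; split=> //; first by split=> //; apply: QD; exact: DZ.
split=> //.
- move=> i ltin; rewrite /phi fes ?mulr0// mem_cat.
  by rewrite (@map_f nat X) ?mem_iota.
- move=> i ltin; have := Q0 _ i (DZ n.+1%:R _ Dy) (ltn_addr n ltin).
  by rewrite /theta ltin.
- move=> i ltin; have := Q0 (n.+1%:R *: y) (n + i)%N (DZ _ _ Dy).
  by rewrite ltn_add2l /theta [(n + i < n)%N]ltnNge leq_addr/= addKn; apply.
- move=> c Cc; rewrite /phi normrM normfV normr_nat.
  by rewrite ler_piMr ?invr_ge0 ?ler0n//; exact: fC.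
Qed.

(** Stage [n] is instructed by [code n = (i, m, s, j)]: [C m] is the thin set to
    treat, and [psi n] has to detect the combination of the vectors with
    coefficients [s] if it lies outside of [V j].  The component [i] is the
    class of the index [n]. *)
Lemma biorthogonal_construction D (C : nat -> set X) (V : nat -> set X)
    (q : nat -> K) (code : nat -> nat * nat * seq nat * nat) :
  linear_subspace D -> (forall n, thin D (C n)) -> fundamental_sequence V ->
  exists (x : nat -> X) (phi psi : nat -> X -> K),
  [/\ forall n, V n (x n),
   forall n, continuous_form (phi n) /\ continuous_form (psi n),
   forall i j, phi i (x j) = (i == j)%:R,
   forall i j, (i < j)%N -> psi i (x j) = 0
   & forall n i m s j, code n = (i, m, s, j) ->
     [/\ forall c, C m c -> `|phi n c| <= n.+1%:R^-1,
       forall w, V j w -> `|psi n w| <= 1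
     & let d := \sum_(l < size s) q s`_l *: x l in
       (size s <= n.+1)%N -> ~ V j d -> psi n d = 1]].
Proof.
move=> Dlin Cthin [Vac V0 VD Vbase].
pose A := {a : X * (X -> K) * (X -> K) |
  [/\ D a.1.1, continuous_form a.1.2 & continuous_form a.2]}.
pose triple0 := (0 : X, fun _ : X => 0 : K, fun _ : X => 0 : K).
have a0P : [/\ D triple0.1.1, continuous_form triple0.1.2
    & continuous_form triple0.2].
  by split; [exact: Dlin.1|exact: continuous_form0|exact: continuous_form0].
pose a0 : A := exist _ _ a0P.
pose vx (a : A) := (sval a).1.1; pose vphi (a : A) := (sval a).1.2.
pose vpsi (a : A) := (sval a).2.
pose comb (h : seq A) (s : seq nat) :=
  \sum_(l < size s) q s`_l *: vx (nth a0 h l).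
pose P (h : seq A) (a : A) := let n := size h in
  [/\ V n (vx a), vphi a (vx a) = 1,
   forall i, (i < n)%N -> [/\ vphi a (vx (nth a0 h i)) = 0,
      vphi (nth a0 h i) (vx a) = 0 & vpsi (nth a0 h i) (vx a) = 0],
   forall c, C (code n).1.1.2 c -> `|vphi a c| <= n.+1%:R^-1
   & (forall w, V (code n).2 w -> `|vpsi a w| <= 1) /\
     (let d := comb (rcons h a) (code n).1.2 in
      ~ V (code n).2 d -> vpsi a d = 1)].
have [|f fP] := @history_choice A P.
  move=> h; pose n := size h.
  pose d x := \sum_(l < size (code n).1.2)
    q (code n).1.2`_l *: nth 0 (rcons (map vx h) x) l.
  have [||||||x [phi [psi [[Dx Vx] cphi cpsi [h1 h2 h3 h4 h5] [h6 h7]]]]] :=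
    @extend_biorthogonal D (C (code n).1.1.2) n (fun i => vx (nth a0 h i))
      (fun i => vphi (nth a0 h i)) (fun i => vpsi (nth a0 h i))
      (V n) (V (code n).2) d Dlin (Cthin _) => //.
  - by move=> i _; have [] := svalP (nth a0 h i).
  - by move=> i _; have [] := svalP (nth a0 h i).
  - by move=> i _; have [] := svalP (nth a0 h i).
  have aP : [/\ D (x, phi, psi).1.1, continuous_form (x, phi, psi).1.2
    & continuous_form (x, phi, psi).2] by [].
  pose a : A := exist _ _ aP.
  exists a; split=> //.
  - by move=> i ltin; split; [exact: h2|exact: h3|exact: h4].
  - split=> //=; suff -> : comb (rcons h a) (code (size h)).1.2 = d x by [].
    apply: eq_bigr => l _; congr (_ *: _).
    (* beyond the end of the history, both default vectors are zero *)
    have [lh|hl] := ltnP l (size (rcons h a)).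
      by rewrite -[x]/(vx a) -map_rcons (nth_map a0).
    by rewrite -[x]/(vx a) -map_rcons !nth_default// size_map.
have fn n i : (i < n)%N -> nth a0 (mkseq f n) i = f i.
  by move=> ?; rewrite nth_mkseq.
pose x n := vx (f n); pose phi n := vphi (f n); pose psi n := vpsi (f n).
exists x, phi, psi; split.
- by move=> n; have [] := fP n; rewrite size_mkseq.
- by move=> n; have [] := svalP (f n).
- move=> i j; have [ltij|ltji|<-] := ltngtP i j.
  + have [_ _ + _ _] := fP j; rewrite size_mkseq => /(_ i ltij)[_].
    by rewrite fn.
  + have [_ _ + _ _] := fP i; rewrite size_mkseq => /(_ j ltji)[+ _ _].
    by rewrite fn.
  + by have [] := fP i.
- move=> i j ltij; have [_ _ + _ _] := fP j.
  by rewrite size_mkseq => /(_ i ltij)[_ _]; rewrite fn.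
- move=> n i m s j codeE; have [_ _ _] := fP n; rewrite size_mkseq codeE/=.
  move=> hC [hV hd]; split=> // sn; suff -> : \sum_(l < size s) q s`_l *: x l =
    comb (rcons (mkseq f n) (f n)) s by [].
  apply: eq_bigr => l _; rewrite -mkseqS fn//.
  exact: leq_trans (ltn_ord l) sn.
Qed.

(** Countably many coefficients are enough to approximate the span; this is why
    countably many forms [psi] can separate its points. *)
Lemma sequence_span_approx (q : nat -> K) (x : nat -> X) (u : X) U :
  (forall a e, 0 < e -> exists n, `|a - q n| < e) ->
  sequence_span x u -> nbhs (0 : X) U ->
  exists s : seq nat, U (u - \sum_(l < size s) q s`_l *: x l).
Proof.
move=> qdense [n [a ->]] U0.
have [V Vfund] := @fundamental_sequence_exists R K X.
have [_ V0 _ Vbase] := Vfund; have [m VU] := Vbase U U0.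
have tP l : exists t, V (m.+1 + l)%N ((a l - q t) *: x l).
  have [e e0 Ve] := nbhs0_absorb (x l) (V0 (m.+1 + l)%N).
  by have [t ht] := qdense (a l) e e0; exists t; exact: Ve.
have [t Vt] := choice tP.
exists (mkseq t n); rewrite size_mkseq -sumrB; apply: VU.
under eq_bigr => l _ do rewrite nth_mkseq// -scalerBl.
exact: (@fundamental_sum _ _ _ V m n (fun l => (a l - q (t l)) *: x l)).
Qed.

(** The subspace consists of the points of the closed span of the constructed
    [x] at which [phi n] depends on the class of [n] only. *)
Theorem spaceable_complement_of_thin D (C : nat -> set X) Y :
  linear_subspace D -> (forall n, thin D (C n)) ->
  (forall y, Y y -> exists n c, C n (c.+1%:R^-1 *: y)) -> spaceable (~` Y).
Proof.
move=> Dlin Cthin YC.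
have [V Vfund] := @fundamental_sequence_exists R K X.
have [Vac V0 VD Vbase] := Vfund.
have [q qdense] := @scalars_dense_seq R k.
have [code codeP] := @enumerate_infinitely_often
  (nat * nat * seq nat * nat)%type (0%N, 0%N, [::], 0%N).
have [x [phi [psi [Vx cform phix psix stage]]]] :=
  biorthogonal_construction q code Dlin Cthin Vfund.
have cphi n := (cform n).1; have cpsi n := (cform n).2.
pose ind n := (code n).1.1.1.
pose S := sequence_span x.
have Slin : linear_subspace S := sequence_span_linear x.
pose F : set X := [set y | closure S y /\
  forall n n', ind n = ind n' -> phi n y = phi n' y].
have Flin : linear_subspace F.
  have [cS0 cSD] := closure_linear_subspace Slin.
  split; first by split=> // n n' _; rewrite !(linear_form0 (cphi _).1).
  move=> a u v [cSu hu] [cSv hv]; split; first exact: cSD.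
  by move=> n n' nn'; rewrite !(cphi _).1 (hu n n')// (hv n n').
have Fclosed : closed F.
  apply/closure_id; rewrite eqEsubset; split; first exact: subset_closure.
  move=> y Fy; split.
    have /closure_id -> := @closed_closure _ S.
    by apply: (@closureS _ F) Fy => z [].
  move=> n n' nn'.
  have := @continuous_form_closure _ _ _ F y
    (continuous_form_comb 1 (-1) (cphi n) (cphi n')).
  rewrite mul1r mulN1r => h; apply/subr0_eq/h => // z [_ hz].
  by rewrite (hz n n' nn') mul1r mulN1r subrr.
have coord n (a : nat -> K) N : phi n (\sum_(l < N) a l *: x l) =
    if (n < N)%N then a n else 0.
  rewrite (linear_form_sum (cphi n).1).
  under eq_bigr do rewrite (linear_formZ (cphi n).1) phix.
  case: ifPn => [nN|]; last rewrite -leqNgt => Nn.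
    rewrite (bigD1 (Ordinal nN))//= eqxx mulr1 big1 ?addr0// => l.
    by rewrite -val_eqE eq_sym => /negPf /= ->; rewrite mulr0.
  rewrite big1// => l _; rewrite gtn_eqF ?mulr0//.
  exact: leq_trans (ltn_ord l) Nn.
have Finf : ~ finite_dimensional F.
  pose z i l := (ind l == i)%:R *: x l.
  have Vz i l : V l (z i l).
    apply: absolutely_convexZ => //; rewrite normr_nat.
    by case: eqP; rewrite ?ler01.
  have [f fz] :=
    choice (fun i => @fundamental_series_cvg _ _ _ V (z i) Vfund (Vz i)).
  have phif n i : phi n (f i) = (ind n == i)%:R.
    pose b := (ind n == i)%:R : K.
    pose A := [set \sum_(l < N) z i l - b *: x n | N in [set N | (n < N)%N]].
    have phiA a : A a -> phi n a = 0.
      move=> [N nN <-]; rewrite (linear_formB (cphi n).1).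
      rewrite (linear_formZ (cphi n).1) phix eqxx mulr1.
      by rewrite (coord n (fun l => (ind l == i)%:R)) nN subrr.
    have : closure A (f i - b *: x n).
      apply/closure_approx => U /(fz i)[N UN].
      exists (\sum_(l < maxn N n.+1) z i l - b *: x n).
        by exists (maxn N n.+1) => //=; rewrite leq_maxr.
      by rewrite opprB addrA subrK; apply: UN; rewrite leq_maxl.
    move=> /(continuous_form_closure (cphi n) phiA)/eqP.
    rewrite (linear_formB (cphi n).1) (linear_formZ (cphi n).1) phix eqxx mulr1.
    by rewrite subr_eq0 => /eqP.
  have gP i : exists n, ind n = i.
    have [n _ nE] := codeP (i, 0%N, [::], 0%N) 0%N.
    by exists n; rewrite /ind nE.
  have [g indg] := choice gP.
  apply: (@biorthogonal_infinite_dimensional _ _ F f (fun i => phi (g i))).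
  - move=> i; split; last by move=> n n' nn'; rewrite !phif nn'.
    apply/closure_approx => U /(fz i)[N UN].
    exists (\sum_(l < N) z i l); last exact: UN.
    by exists N, (fun l => (ind l == i)%:R).
  - by move=> i; exact: (cphi _).1.
  - by move=> i j; rewrite phif indg.
exists F; split=> // y [cSy Fy]; have [Yy|] := pselect (Y y); last by left.
right; have [n [c Cy]] := YC y Yy.
have c0 : 0 < c.+1%:R :> K by rewrite ltr0n.
(* the class of [l] contains arbitrarily late indices that treat [C n] *)
have phiy l : phi l y = 0.
  have [//|] := eqVneq (phi l y) 0; rewrite -normr_gt0 => by0.
  have [N hN] := scalars_archimedean (divr_gt0 by0 c0).
  have [l' Nl' codel'] := codeP (ind l, n, [::], 0%N) N.
  have [/(_ _ Cy) + _ _] := stage _ _ _ _ _ codel'.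
  rewrite (linear_formZ (cphi _).1) normrM normfV normr_nat.
  rewrite -(Fy l l') ?/ind ?codel'// mulrC => h.
  have : l'.+1%:R^-1 <= N.+1%:R^-1 :> K.
    by rewrite lef_pV2 ?posrE ?ltr0n// ler_nat.
  by move=> /(le_trans h)/le_lt_trans/(_ hN); rewrite ltxx.
(* on the span, [psi l] is a combination of the [phi i] with [i <= l] *)
have psiy l : psi l y = 0.
  have := @continuous_form_closure _ _ _ S y
    (continuous_form_comb 1 (-1) (cpsi l)
      (continuous_form_sum l.+1 (fun i => psi l (x i)) cphi)).
  rewrite [X in _ + _ * X]big1 => [|i _]; last by rewrite phiy mulr0.
  rewrite mulr0 addr0 mul1r; apply => // _ [N [a ->]].
  rewrite mul1r mulN1r (linear_form_sum (cpsi l).1).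
  apply/eqP; rewrite subr_eq0; apply/eqP; under [RHS]eq_bigr => i _ do
    rewrite (linear_form_sum (cphi i).1) mulr_sumr.
  rewrite exchange_big/=; apply: eq_bigr => j _.
  rewrite (linear_formZ (cpsi l).1).
  under eq_bigr do rewrite (linear_formZ (cphi _).1) phix.
  have [jl|lj] := ltnP j l.+1.
    rewrite (bigD1 (Ordinal jl))//= eqxx mulr1 big1 ?addr0 1?mulrC// => i.
    by rewrite -val_eqE/= => /negPf ->; rewrite !mulr0.
  rewrite psix// mulr0 big1// => i _.
  by rewrite ltn_eqF ?mulr0// (leq_trans (ltn_ord i)).
(* otherwise some combination [d] of the vectors is so close to [y] that the
   form detecting [d] does not vanish at [y] *)
apply: contrapT => /eqP y0.
have [U U0 NUy] := frechet_separated y0; have [m VU] := Vbase U U0.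
have /closure_approx/(_ _ (V0 m.+3))[u Su yu] := cSy.
have [s us] := sequence_span_approx qdense Su (V0 m.+3).
pose d := \sum_(l < size s) q s`_l *: x l.
have yd : V m.+2 (y - d) by rewrite -(subrK u y) -addrA; exact: VD.
have Nd : ~ V m.+1 d.
  move=> Vd; apply/NUy/VU; rewrite -(subrK d y); apply: (VD m) => //.
  by rewrite -[y - d]addr0; apply: VD => //; exact: nbhs_singleton.
have [l sl codel] := codeP (0%N, 0%N, s, m.+1) (size s).
have [_ psiV /(_ (leqW sl) Nd) psid] := stage _ _ _ _ _ codel.
have := psiV _ (VD _ _ _ yd yd).
rewrite (linear_formD (cpsi l).1) (linear_formB (cpsi l).1) psiy psid sub0r.
by rewrite -opprD normrN -(natrD _ 1 1) normr_nat lern1.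
Qed.

End ThinSets.

(** * Ranges of operators *)

Section OperatorRanges.
Context {R : realType} {k : scalar_kind}.
Local Notation K := (scalars R k).
Context {Z : nat -> frechetType R K} {X : frechetType R K}.
Context {T : forall n : nat, {linear Z n -> X}}.
Context (Tcont : forall n, continuous (T n)).
Context {V : forall i, nat -> set (Z i)}.
Arguments V : clear implicits.
Context (Vfund : forall i, fundamental_sequence (V i)).

Definition sum_range n : set X :=
  [set x | exists z : forall i, Z i, x = \sum_(i < n) T i (z i)].

(** The image of the [m]-th basic neighbourhood of the product of the first [n]
    spaces. *)
Definition sum_image n m : set X := [set x | exists2 z : forall i, Z i,
  forall i, (i < n)%N -> V i m (z i) & x = \sum_(i < n) T i (z i)].

Lemma sum_range_linear n : linear_subspace (sum_range n).
Proof.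
split; first by exists (fun=> 0); rewrite big1// => i _; rewrite linear0.
move=> a _ _ [z ->] [z' ->]; exists (fun i => a *: z i + z' i).
by rewrite scaler_sumr -big_split/=; apply: eq_bigr => i _; rewrite linearP.
Qed.

Lemma sum_range_mono n n' : (n <= n')%N -> sum_range n `<=` sum_range n'.
Proof.
move=> nn' _ [z ->]; exists (fun i => if (i < n)%N then z i else 0).
rewrite (big_ord_widen _ (fun i => T i (z i)) nn') big_mkcond/=.
by apply: eq_bigr => i _; case: ifP => //; rewrite linear0.
Qed.

Lemma sum_image_absolutely_convex n m : absolutely_convex (sum_image n m).
Proof.
move=> a b _ _ ab [z Vz ->] [z' Vz' ->]; exists (fun i => a *: z i + b *: z' i).
  by move=> i ltin; have [Vac _ _ _] := Vfund i; apply: Vac; auto.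
rewrite !scaler_sumr -big_split/=; apply: eq_bigr => i _.
by rewrite linearP linearZ.
Qed.

Lemma sum_image_absorbs n m x : sum_range n x ->
  exists c, sum_image n m (c.+1%:R^-1 *: x).
Proof.
move=> [z ->].
have [c Vc] : exists c, forall i, (i < n)%N ->
    forall c', (c <= c')%N -> V i m (c'.+1%:R^-1 *: z i).
  elim: n => [|n [c Vc]]; first by exists 0%N.
  have [_ V0 _ _] := Vfund n; have [e e0 Ve] := nbhs0_absorb (z n) (V0 m).
  have [N hN] := scalars_archimedean e0.
  exists (maxn c N) => i; rewrite ltnS leq_eqVlt => /predU1P[->|ltin] c'.
    rewrite geq_max => /andP[_ Nc']; apply: Ve; apply: le_lt_trans hN.
    by rewrite normfV normr_nat lef_pV2 ?posrE ?ltr0n// ler_nat.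
  by rewrite geq_max => /andP[cc' _]; exact: Vc.
exists c, (fun i => c.+1%:R^-1 *: z i); first by move=> i ltin; exact: Vc.
by rewrite scaler_sumr; apply: eq_bigr => i _; rewrite linearZ.
Qed.

Lemma small_images n U (w : forall i, nat -> Z i) : nbhs (0 : X) U ->
  (forall i, (i < n)%N -> forall W, nbhs (0 : Z i) W ->
    exists N, forall m, (N <= m)%N -> W (w i m)) ->
  exists N, forall m, (N <= m)%N -> U (\sum_(i < n) T i (w i m)).
Proof.
elim: n U => [|n IH] U U0 w0.
  by exists 0%N => m _; rewrite big_ord0; exact: nbhs_singleton.
have [W W0 WU] := nbhs0_addW U0.
have [|N1 h1] := IH W W0; first by move=> i ltin; apply: w0; exact: ltnW.
have TW : nbhs (0 : Z n) (T n @^-1` W).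
  by apply: Tcont; rewrite linear0.
have [N2 h2] := w0 n (ltnSn n) _ TW.
exists (maxn N1 N2) => m; rewrite geq_max => /andP[m1 m2].
by rewrite big_ord_recr/=; apply: WU; [exact: h1|exact: h2].
Qed.

(** Successive approximation, as in the open mapping theorem: [r m] is the error
    left after [m] steps, and the corrections in each [Z i] form a convergent
    series. *)
Lemma almost_open_closure_sub n (D : set X) : linear_subspace D ->
  sum_range n `<=` closure D ->
  (forall m, exists2 W, nbhs (0 : X) W &
    forall d, D d -> W d -> closure (sum_image n m) d) ->
  closure D `<=` sum_range n.
Proof.
move=> Dlin SD almost_open.
have cDlin := closure_linear_subspace Dlin.
have [B Bfund] := @fundamental_sequence_exists R K X.
have [_ B0 _ Bbase] := Bfund.
have /choice[G GP] : forall m, exists G, nbhs (0 : X) G /\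
    forall r, closure D r -> G r -> closure (sum_image n m) r.
  move=> m; have [W W0 DW] := almost_open m.
  have [W' W'0 WW'] := nbhs0_addW W0.
  exists W'; split=> // r /closure_approx Dr W'r; apply/closure_approx => U U0.
  have [U' U'0 UU'] := nbhs0_addW U0.
  have [d Dd [U'd /= W'd]] := Dr _ (filterI U'0 (nbhs0_scale (-1) W'0)).
  have Wd : W d.
    by rewrite -(subrK r d) addrC; apply: WW' => //; rewrite -opprB -scaleN1r.
  have /closure_approx/(_ _ U'0)[b Cb U'b] := DW d Dd Wd.
  by exists b => //; rewrite -(subrK d r) -addrA; exact: UU'.
have G0 m : nbhs (0 : X) (G m) := (GP m).1.
pose good m r := [/\ closure D r, G m r & B m r].
have /choice[g gP] : forall mr : nat * X, exists z : forall i, Z i,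
    good mr.1 mr.2 -> (forall i, (i < n)%N -> V i mr.1 (z i)) /\
    good mr.1.+1 (mr.2 - \sum_(i < n) T i (z i)).
  move=> [m r] /=; have [[Dr Gr Or]|nr] := pselect (good m r); last first.
    by exists (fun=> 0).
  have /closure_approx/(_ _ (filterI (G0 m.+1) (B0 m.+1))) := (GP m).2 r Dr Gr.
  move=> [_ [z Vz ->] [Gz Oz]]; exists z; split=> //; split=> //.
  rewrite addrC -scaleN1r; apply: cDlin.2 => //.
  by apply: SD; exists z.
move=> x Dx.
have [c c0 good0] : exists2 c : K, c != 0 & good 0%N (c *: x).
  have [c c0 [Gc Oc]] := nbhs0_absorbing x (filterI (G0 0%N) (B0 0%N)).
  by exists c => //; split=> //; exact: (linear_subspaceZ cDlin).
suff : sum_range n (c *: x).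
  move=> /(linear_subspaceZ (sum_range_linear n) c^-1).
  by rewrite scalerA mulVf// scale1r.
pose r := fix r m :=
  if m is m'.+1 then r m' - \sum_(i < n) T i (g (m', r m') i) else c *: x.
have rgood m : good m (r m).
  by elim: m => //= m IH; exact: (gP (m, r m) IH).2.
pose z i m := g (m, r m) i.
have Vz i m : (i < n)%N -> V i m (z i m) by apply: (gP (m, r m) (rgood m)).1.
have sP i : exists s, (i < n)%N -> forall W, nbhs (0 : Z i) W ->
    exists N, forall m, (N <= m)%N -> W (s - \sum_(l < m) z i l).
  have [ltin|_] := boolP (i < n)%N; last by exists 0.
  have [s hs] := fundamental_series_cvg (Vfund i) (fun m => Vz i m ltin).
  by exists s.
pose s i := sval (cid (sP i)).
exists s; apply/subr0_eq.
have [//|/frechet_separated[U U0 NU]] :=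
  eqVneq (c *: x - \sum_(i < n) T i (s i)) 0.
exfalso; apply: NU.
have rE m : r m = c *: x - \sum_(i < n) T i (\sum_(l < m) z i l).
  elim: m => [|m IH].
    by rewrite big1 ?subr0// => i _; rewrite big_ord0 linear0.
  rewrite [LHS]/= {1}IH -addrA -opprD -big_split/=; congr (_ - _).
  by apply: eq_bigr => i _; rewrite big_ord_recr/= linearD.
have [W W0 WU] := nbhs0_addW U0.
have [N1 h1] :=
  small_images (nbhs0_scale (-1) W0) (fun i => svalP (cid (sP i))).
have [N2 h2] := Bbase W W0.
pose N := maxn N1 N2.
have -> : c *: x - \sum_(i < n) T i (s i) =
    -1 *: (\sum_(i < n) T i (s i - \sum_(l < N) z i l)) + r N.
  rewrite rE scaleN1r.
  under [in RHS]eq_bigr do rewrite linearB.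
  by rewrite sumrB opprB [RHS]addrC addrA subrK.
apply: WU; first by apply: h1; exact: leq_maxl.
apply/h2/(fundamental_decr Bfund (leq_maxr N1 N2)).
by have [] := rgood N.
Qed.

End OperatorRanges.

(** * Spaceability of the complement of [Y] *)

Theorem theorem3p1 (R : realType) (k : scalar_kind)
    (Z : nat -> frechetType R (scalars R k)) (X : frechetType R (scalars R k))
    (T : forall n : nat, {linear Z n -> X})
    (T_continuous : forall n : nat, continuous (T n)) :
  let Y : set X := lin_span (\bigcup_n range (T n)) in
  ~ closed Y -> spaceable (~` Y).
Proof.
move=> Y NcY.
pose V i := sval (cid (@fundamental_sequence_exists R (scalars R k) (Z i))).
have Vfund i : fundamental_sequence (V i) by exact: svalP.
pose S := @sum_range R k Z X T; pose B := @sum_image R k Z X T V.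
have Slin n : linear_subspace (S n) by exact: sum_range_linear.
have Smono n m : (n <= m)%N -> S n `<=` S m by exact: sum_range_mono.
have SY n : S n `<=` Y.
  move=> _ [z ->]; exists n, (fun=> 1), (fun i => T i (z i)); split.
    by move=> i; exists i => //; exists (z i).
  by under [RHS]eq_bigr do rewrite scale1r.
have Ulin : linear_subspace [set y | exists n, S n y].
  split; first by exists 0%N; exact: (Slin _).1.
  move=> a u v [n Su] [m Sv]; exists (maxn n m); apply: (Slin _).2.
    exact: Smono (leq_maxl _ _) _ Su.
  exact: Smono (leq_maxr _ _) _ Sv.
have YS y : Y y -> exists n, S n y.
  move=> [n [a [v [vT ->]]]]; apply: (linear_subspace_sum Ulin) => i.
  apply: (linear_subspaceZ Ulin); have [m _ [z _ <-]] := vT i.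
  exists m.+1, (dfwith (fun j => 0 : Z j) m z).
  rewrite big_ord_recr/= dfwithin big1 ?add0r// => j _.
  by rewrite dfwithout ?linear0// gtn_eqF.
have Ylin : linear_subspace Y.
  split; first exact: SY 0%N _ (Slin _).1.
  move=> a u v /YS Uu /YS Uv; have [n Sn] := Ulin.2 a u v Uu Uv; exact: SY Sn.
have [[n0 Yn0]|NYS] := pselect (exists n0, Y `<=` closure (S n0)); last first.
  apply: (@spaceable_complement_of_thin R k X Y S Y) => //.
    apply: thin_subspace => // [n YSn|a y]; first by apply: NYS; exists n.
    exact: linear_subspaceZ.
  by move=> y /YS[n Sn]; exists n, 0%N; exact: linear_subspaceZ.
have mP n : exists m, (n0 <= n)%N ->
    forall W, nbhs (0 : X) W ->
    exists d, [/\ S n0 d, W d & ~ closure (B n m) d].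
  have [n0n|] := boolP (n0 <= n)%N; last by exists 0%N.
  apply: contrapT => Nm; apply: NcY; apply/closure_id.
  rewrite eqEsubset; split; first exact: subset_closure.
  move=> y Yy; apply: (SY n).
  apply: (almost_open_closure_sub T_continuous Vfund (Slin n0)).
  - exact: subset_trans (SY n) Yn0.
  - move=> m; apply: contrapT => NW; apply: Nm; exists m => _ W W0.
    apply: contrapT => Nd; apply: NW; exists W => // d Sd Wd.
    by apply: contrapT => NBd; apply: Nd; exists d.
  - have := closureS Yn0 Yy.
    by rewrite -(closure_id _).1//; exact: closed_closure.
have [m hm] := choice mP.
apply: (@spaceable_complement_of_thin R k X (S n0)
  (fun n => B (n0 + n)%N (m (n0 + n)%N))).
- exact: Slin.
- move=> n; apply: thin_of_closure.
  + exact: Slin.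
  + exact: sum_image_absolutely_convex.
  + move=> e Se; apply: sum_image_absorbs => //.
    by apply: Smono Se; exact: leq_addr.
  + by apply: hm; exact: leq_addr.
- move=> y /YS[n Sn]; exists n.
  by apply: sum_image_absorbs => //; apply: Smono Sn; exact: leq_addl.
Qed.
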